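(* Let $\lambda\in\mathbb{R}$. For all $k,m\in\mathbb{Z}$ with $k,m\ge 0$, $$S_{2,\lambda}(m+k+1,m)=\sum_{l=0}^{m}\big(l-(k+l)\lambda\big)S_{2,\lambda}(k+l,l).$$
   Context: For $\lambda\in\mathbb{R}$, the generalized falling factorials are $(x)_{0,\lambda}=1$, $(x)_{n,\lambda}=x(x-\lambda)\cdots(x-(n-1)\lambda)$ for $n\ge 1$, and the ordinary falling factorials are $(x)_{0}=1$, $(x)_{n}=x(x-1)\cdots(x-n+1)$ for $n\ge 1$. The degenerate Stirling numbers of the second kind $S_{2,\lambda}(n,k)$, $0\le k\le n$, are defined by the polynomial identity $(x)_{n,\lambda}=\sum_{k=0}^{n}S_{2,\lambda}(n,k)(x)_{k}$ for $n\ge 0$. *)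

(* Defs.v *)
From HB Require Import structures.
From mathcomp Require Import all_boot all_order all_algebra.
From mathcomp Require Import boolp reals.
Set Implicit Arguments.
Unset Strict Implicit.
Unset Printing Implicit Defensive.
Import Order.TTheory GRing.Theory Num.Theory.
Local Open Scope ring_scope.

(* (x)_n and (x)_{n,lambda}, as polynomials in the indeterminate 'X. *)

Definition falling (R : realType) (n : nat) : {poly R} :=
  \prod_(i < n) ('X - i%:R%:P).

Definition dfalling (R : realType) (lambda : R) (n : nat) : {poly R} :=
  \prod_(i < n) ('X - (i%:R * lambda)%:P).

(* Only the values S n k with k <= n are constrained. *)
Definition is_dstirling2 (R : realType) (lambda : R) (S : nat -> nat -> R) :
    Prop :=
  forall n, dfalling lambda n = \sum_(k < n.+1) S n k *: falling R k.

Lemma size_falling (R : realType) (n : nat) : size (falling R n) = n.+1.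
Proof. by rewrite size_prod_XsubC /index_enum -enumT size_enum_ord. Qed.

Lemma falling_monic (R : realType) (n : nat) : falling R n \is monic.
Proof. exact: monic_prod_XsubC. Qed.

Lemma falling_span (R : realType) (n : nat) (p : {poly R}) :
  (size p <= n)%N ->
  exists a : nat -> R, p = \sum_(k < n) a k *: falling R k.
Proof.
elim: n p => [|n IHn] p sp.
  exists (fun=> 0); rewrite big_ord0.
  by apply/eqP; rewrite -size_poly_eq0 -leqn0.
have [|a pa] := IHn (p - p`_n *: falling R n).
  apply/leq_sizeP => j; rewrite leq_eqVlt coefB coefZ => /orP[/eqP<-|nj].
    have := monicP (falling_monic R n).
    by rewrite lead_coefE size_falling /= => ->; rewrite mulr1 subrr.
  rewrite [p`_j]nth_default; last exact: leq_trans sp nj.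
  by rewrite [_`_j]nth_default ?size_falling // mulr0 subrr.
exists (fun k => if k == n then p`_n else a k).
rewrite big_ord_recr /= eqxx -{1}(subrK (p`_n *: falling R n) p) pa.
by congr (_ + _); apply: eq_bigr => i _; rewrite ltn_eqF.
Qed.

Lemma falling_free (R : realType) (n : nat) (a : nat -> R) :
  \sum_(k < n) a k *: falling R k = 0 -> forall k, (k < n)%N -> a k = 0.
Proof.
elim: n => // n IHn; rewrite big_ord_recr /= => sum0.
have an0 : a n = 0.
  have := congr1 (fun p : {poly R} => p`_n) sum0.
  rewrite /= coefD coef_sum coef0 big1 => [|i _]; last first.
    by rewrite coefZ nth_default ?mulr0 ?size_falling.
  have := monicP (falling_monic R n).
  by rewrite lead_coefE size_falling /= coefZ => ->; rewrite mulr1 add0r.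
move: sum0; rewrite an0 scale0r addr0 => /IHn ak0 k.
by rewrite ltnS leq_eqVlt => /orP[/eqP->|/ak0].
Qed.

Lemma dstirling2_exists (R : realType) (lambda : R) :
  exists S, is_dstirling2 lambda S.
Proof.
have size_d n : (size (dfalling lambda n) <= n.+1)%N.
  by rewrite size_prod_XsubC /index_enum -enumT size_enum_ord.
exists (fun n => sval (cid (falling_span (size_d n)))) => n.
exact: (svalP (cid (falling_span (size_d n)))).
Qed.

Lemma dstirling2_unique (R : realType) (lambda : R) (S T : nat -> nat -> R) :
  is_dstirling2 lambda S -> is_dstirling2 lambda T ->
  forall n k, (k <= n)%N -> S n k = T n k.
Proof.
move=> HS HT n k kn; apply/eqP; rewrite -subr_eq0; apply/eqP.
apply: (@falling_free R n.+1 (fun k => S n k - T n k)) => //.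
under eq_bigr do rewrite scalerBl.
by rewrite sumrB -HS -HT subrr.
Qed.

(* S_{2,lambda}(n, k): the coefficients of the defining identity, unique for
   k <= n by dstirling2_unique; for k > n the value is unspecified. *)
Definition dstirling2 (R : realType) (lambda : R) : nat -> nat -> R :=
  sval (cid (dstirling2_exists lambda)).

Lemma dstirling2P (R : realType) (lambda : R) :
  is_dstirling2 lambda (dstirling2 lambda).
Proof. exact: (svalP (cid (dstirling2_exists lambda))). Qed.

(* Main.v *)
Require Import Defs.
From mathcomp Require Import all_boot all_order all_algebra.
From mathcomp Require Import reals.
Import Order.TTheory GRing.Theory Num.Theory.
Local Open Scope ring_scope.

(** Comparing [(x)_{n+1,lambda} = (x)_{n,lambda} (x - n lambda)] with
    [x (x)_j = (x)_{j+1} + j (x)_j] in the basis of falling factorials gives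
    the triangular recurrence
    [S(n+1, j) = S(n, j-1) + (j - n lambda) S(n, j)].
    Unrolling it along the diagonal from [S(m+k+1, m)] down to column [0]
    peels off one summand at each step, and the recurrence in column [0],
    which has no [S(n, j-1)] term, provides the summand of index [0]. *)

(** The shift [j - c] is what multiplication by ['X - c] leaves on the
    diagonal, because [(x)_(j+1) = (x)_j (x - j)]. *)
Lemma falling_mulXsubC (R : realType) (c : R) (j : nat) :
  falling R j * ('X - c%:P) = falling R j.+1 + (j%:R - c) *: falling R j.
Proof.
have -> : falling R j.+1 = falling R j * ('X - j%:R%:P).
  by rewrite /falling big_ord_recr.
by rewrite -mul_polyC [_%:P * _]mulrC -mulrDr polyCB addrA subrK.
Qed.

(** Both sides of the recurrence are the coefficient of [(x)_j] in
    [(x)_{n+1,lambda}]. The bound on [j] keeps [S(n, j)] among the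
    coefficients that the defining identity determines. *)
Lemma dstirling2_recurrence (R : realType) (lambda : R) (n j : nat) :
  (j <= n)%N ->
  dstirling2 lambda n.+1 j =
  (if j is i.+1 then dstirling2 lambda n i else 0)
  + (j%:R - n%:R * lambda) * dstirling2 lambda n j.
Proof.
move=> le_jn; set S := dstirling2 lambda; set c := n%:R * lambda.
pose shifted i := if i is i'.+1 then S n i' else 0.
(* [S n n.+1] is unspecified, so the diagonal part is cut off there. *)
pose diagonal i := if (i <= n)%N then (i%:R - c) * S n i else 0.
suff: S n.+1 j - (shifted j + diagonal j) = 0.
  by move/eqP; rewrite subr_eq0 /diagonal le_jn => /eqP.
apply: (@falling_free R n.+2 (fun i => S n.+1 i - (shifted i + diagonal i)));
  last by rewrite ltnS leqW.
under eq_bigr do rewrite scalerBl scalerDl.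
rewrite sumrB -(dstirling2P lambda n.+1) big_split /=.
rewrite [\sum_(i < n.+2) shifted i *: _]big_ord_recl /= scale0r add0r.
rewrite [\sum_(i < n.+2) diagonal i *: _]big_ord_recr /=.
rewrite {2}/diagonal ltnn scale0r addr0.
apply/eqP; rewrite subr_eq0 -big_split /=; apply/eqP.
rewrite /dfalling big_ord_recr /= -/(dfalling lambda n) (dstirling2P lambda n).
rewrite mulr_suml; apply: eq_bigr => i _.
rewrite -scalerAl falling_mulXsubC scalerDr scalerA.
by rewrite /diagonal -ltnS ltn_ord [_ * S n i]mulrC.
Qed.

Theorem theorem9 (R : realType) (lambda : R) (k m : nat) :
  dstirling2 lambda (m + k + 1)%N m =
  \sum_(0 <= l < m.+1)
    (l%:R - (k + l)%:R * lambda) * dstirling2 lambda (k + l)%N l.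
Proof.
elim: m => [|m IHm].
  by rewrite big_nat1 add0n addn0 addn1 dstirling2_recurrence // add0r.
rewrite big_nat_recr //= -IHm addn1 dstirling2_recurrence ?leq_addr //.
by rewrite addn1 addSn [(k + m.+1)%N]addnC addSn.
Qed.
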